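(* Let $s$ and $t$ be integers. If $s + 1 \ge t \ge 6$, then $\mu(P_s \Box C_t) = 2t$.
   Context: All graphs are finite, simple and undirected. For a graph $G$ and $M \subseteq V(G)$, a shortest $u,v$-path $P$ of $G$ is called $M$-unhindered if $P$ does not contain a vertex of $M \setminus \{u,v\}$. Vertices $u,v \in M$ are $M$-visible if $G$ admits an $M$-unhindered (shortest) $u,v$-path. The set $M$ is a mutual-visibility set of $G$ if its vertices are pairwise $M$-visible. The mutual-visibility number $\mu(G)$ is the size of a largest mutual-visibility set of $G$. The Cartesian product $G \Box H$ has vertex set $V(G)\times V(H)$, with $(x_1,x_2)$ and $(y_1,y_2)$ adjacent whenever $x_1y_1\in E(G)$ and $x_2=y_2$, or $x_2y_2\in E(H)$ and $x_1=y_1$. $P_s$ ($s \ge 2$) denotes the path on $s$ vertices $\{0,1,\ldots,s-1\}$ and $C_t$ ($t\ge 3$) the cycle on $t$ vertices $\{0,1,\ldots,t-1\}$. *)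

(* Defs.v *)
From mathcomp Require Import all_boot.
From mathcomp Require Import boolp.

Set Implicit Arguments.
Unset Strict Implicit.
Unset Printing Implicit Defensive.

Record sgraph := SGraph {
  vertex :> finType;
  adj : rel vertex;
  adj_sym : symmetric adj;
  adj_irr : irreflexive adj
}.

(* As in mathcomp's path library, a walk is given by its first vertex [u] and
   the sequence [p] of the remaining ones, so [size p] is its number of edges. *)
Definition is_path (G : sgraph) (u v : G) (p : seq G) : bool :=
  [&& path (@adj G) u p, last u p == v & uniq (u :: p)].

Definition shortest_path (G : sgraph) (u v : G) (p : seq G) : Prop :=
  is_path u v p /\ forall q : seq G, is_path u v q -> size p <= size q.

Definition unhindered (G : sgraph) (M : {set G}) (u v : G) (p : seq G) : Prop :=
  shortest_path u v p /\ forall x, x \in u :: p -> x \notin M :\: [set u; v].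

Definition visible (G : sgraph) (M : {set G}) (u v : G) : Prop :=
  exists p : seq G, unhindered M u v p.

Definition mutual_visibility_set (G : sgraph) (M : {set G}) : Prop :=
  forall u v : G, u \in M -> v \in M -> visible M u v.

Definition mu (G : sgraph) : nat :=
  \max_(M : {set G} | `[< mutual_visibility_set M >]) #|M|.

Section CartesianProduct.
Variables G H : sgraph.

Definition cart_adj : rel (G * H) := fun x y =>
  (adj x.1 y.1 && (x.2 == y.2)) || (adj x.2 y.2 && (x.1 == y.1)).

Lemma cart_adj_sym : symmetric cart_adj.
Proof.
by move=> x y; rewrite /cart_adj !(adj_sym x.1) !(adj_sym x.2) !(eq_sym y.1) !(eq_sym y.2).
Qed.

Lemma cart_adj_irr : irreflexive cart_adj.
Proof. by move=> x; rewrite /cart_adj !adj_irr. Qed.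

Definition cart_prod : sgraph := SGraph cart_adj_sym cart_adj_irr.

End CartesianProduct.

Notation "G □ H" := (cart_prod G H) (at level 40, left associativity).

Definition path_adj (s : nat) : rel 'I_s := fun i j =>
  (i.+1 == j :> nat) || (j.+1 == i :> nat).

Lemma path_adj_sym s : symmetric (@path_adj s).
Proof. by move=> i j; rewrite /path_adj orbC. Qed.

Lemma path_adj_irr s : irreflexive (@path_adj s).
Proof. by move=> i; rewrite /path_adj orbb eqn_leq ltnn. Qed.

Definition path_graph (s : nat) : sgraph :=
  SGraph (@path_adj_sym s) (@path_adj_irr s).

(* The conjunct [i != j] only matters for [t = 1], where it excludes a loop;
   this is the cycle C_t for [3 <= t]. *)
Definition cycle_adj (t : nat) : rel 'I_t := fun i j =>
  (i != j) && ((i.+1 %% t == j) || (j.+1 %% t == i)).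

Lemma cycle_adj_sym t : symmetric (@cycle_adj t).
Proof. by move=> i j; rewrite /cycle_adj eq_sym orbC. Qed.

Lemma cycle_adj_irr t : irreflexive (@cycle_adj t).
Proof. by move=> i; rewrite /cycle_adj eqxx. Qed.

Definition cycle_graph (t : nat) : sgraph :=
  SGraph (@cycle_adj_sym t) (@cycle_adj_irr t).

(* Main.v *)
Require Import Defs.
From mathcomp Require Import all_boot.
From mathcomp Require Import boolp zify.

Set Implicit Arguments.
Unset Strict Implicit.
Unset Printing Implicit Defensive.

(** A vertex of the cylinder is a pair (row, column): the row lies on the path
and the column on the cycle.  A shortest path is monotone in the rows and runs
along a shortest arc in the columns, so it is exactly a walk whose length is
the row gap plus the cyclic distance of the columns ([gdist_path],
[geodesic_visible]).

Upper bound: the only geodesic between two vertices of one column is the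
vertical segment, so a third vertex between them would block it.  Hence every
column holds at most two vertices of a mutual-visibility set, and there are
[t] columns.

Lower bound: on the first [t - 1] rows one places exactly two vertices in each
column, in rows [lo c < hi c].  The organizing idea is that nearly every
occupied row holds just two vertices, at cyclic distance [t./2]; neither of
them lies in the interior of a shortest arc that starts at the other, so such a
row is transparent to its own vertices ([balanced_arc]).  Two vertices in
different columns then see each other along one corner (column first, then the
row of the upper one, or row first, then the column of the upper one) unless
the second vertex of one of the two columns is in the way ([corner_up],
[corner_right]).  When the intervals [lo c, hi c] are nested, this fails for
few pairs only: antipodal vertices with the same interval, and some pairs that
involve one of the two extreme rows, which hold three vertices each.  These
pairs are served by explicit staircases ([route5], [route7]).

With [t = 2 * h + 1], the intervals are centrally nested and columns [0], [h],
[2 * h] share the longest one.  With [t = 2 * h] there is one row less; this is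
compensated in the antipodal columns [0] and [h], whose intervals share the
middle row and span one half of the rows each.  The staircases for these two
columns need [h >= 4]; for [t = 6] another placement is checked by evaluation
([six_climb]). *)

(** * Distances in the cylinder *)

(** [gap] and [cdist] are the distances in the path and in the cycle. *)
Definition gap (a b : nat) : nat := (a - b) + (b - a).

Definition cdist (t a b : nat) : nat := minn (gap a b) (t - gap a b).

Definition cstep (t a b : nat) : bool := (a.+1 == b) || (a.+1 == t) && (b == 0).

Lemma cycle_adjE t (i j : 'I_t) :
  1 < t -> adj (s := cycle_graph t) i j = cstep t i j || cstep t j i.
Proof.
move=> t1; rewrite /adj /= /cycle_adj /cstep.
have succ_mod (k : 'I_t) : k.+1 %% t = if k.+1 == t then 0 else k.+1.
  have := ltn_ord k; case: eqP => [->|] *; first by rewrite modnn.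
  by rewrite modn_small //; lia.
rewrite !succ_mod -val_eqE /=; have := ltn_ord i; have := ltn_ord j.
by case: (i.+1 =P t); case: (j.+1 =P t); lia.
Qed.

Section Cylinder.
Variables s t : nat.
Hypothesis t_gt1 : 1 < t.
Let G := path_graph s □ cycle_graph t.

Lemma cyl_adjE (u v : G) :
  adj u v = ((u.1.+1 == v.1 :> nat) || (v.1.+1 == u.1 :> nat))
              && (u.2 == v.2 :> nat)
         || (cstep t u.2 v.2 || cstep t v.2 u.2) && (u.1 == v.1 :> nat).
Proof. by case: u v => [a b] [c d]; rewrite {1}/adj /= /cart_adj cycle_adjE. Qed.

Definition gdist (u v : G) : nat := gap u.1 v.1 + cdist t u.2 v.2.

Lemma gdist_step (u w v : G) : adj u w -> gdist u v <= (gdist w v).+1.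
Proof.
rewrite cyl_adjE /gdist /cdist /cstep /gap.
have := ltn_ord u.2; have := ltn_ord w.2; have := ltn_ord v.2.
move: (nat_of_ord u.1) (nat_of_ord u.2) (nat_of_ord v.1) (nat_of_ord v.2)
  (nat_of_ord w.1) (nat_of_ord w.2) => a i b k c j ? ? ?.
by case/orP=> [/andP[ac /eqP ->] | /andP[ij /eqP ->]]; lia.
Qed.

(** The potential [gdist _ v] drops by at most one along an edge. *)
Lemma gdist_path (u : G) (p : seq G) :
  path (@adj G) u p -> gdist u (last u p) <= size p.
Proof.
elim: p u => [u _ | w p IHp u /= /andP[uw /IHp wp]].
  by rewrite /gdist /cdist /gap /=; lia.
exact: leq_trans (gdist_step _ uw) _.
Qed.

(** Any walk of length [gdist u v] is a shortest path, so visibility is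
witnessed without checking that vertices do not repeat. *)
Lemma geodesic_visible (M : {set G}) (u v : G) (p : seq G) :
  path (@adj G) u p -> last u p = v -> size p <= gdist u v ->
  (forall w, w \in u :: p -> w \in M -> w = u \/ w = v) -> visible M u v.
Proof.
move=> up pv; move: pv; case/shortenP: up => q uq uniq_q sub_qp qv sz_p freeM.
have sz_q : size q <= size p by apply: uniq_leq_size => //; case/andP: uniq_q.
exists q; split; first split.
- by rewrite /is_path uq qv eqxx.
- move=> r /and3P[ur /eqP rv _]; apply: leq_trans (leq_trans sz_q sz_p) _.
  by rewrite -rv; exact: gdist_path.
- move=> w; rewrite !inE => wq; apply/negP => /andP[/norP[wu wv] wM].
  have /freeM/(_ wM)[] : w \in u :: p; last 2 first.
  + by move/eqP; rewrite (negPf wu).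
  + by move/eqP; rewrite (negPf wv).
  + by rewrite inE; case/orP: wq => [->//|/sub_qp ->]; rewrite orbT.
Qed.

(** * At most two vertices per column *)
Lemma vertical_path (u : G) (k : nat) :
  u.1 + k < s -> exists p, [/\ path (@adj G) u p, size p = k,
    uniq (u :: p), all (fun w : G => u.1 <= w.1) p
    & (last u p).1 = u.1 + k :> nat /\ (last u p).2 = u.2].
Proof.
elim: k u => [|k IHk] u lt_s; first by exists [::]; rewrite /= addn0.
have lt1 : u.1.+1 < s by lia.
have [|p [pp sz un al [l1 l2]]] := IHk ((Ordinal lt1, u.2) : G); first by rewrite /= addSnnS.
have uw : adj u ((Ordinal lt1, u.2) : G) by rewrite cyl_adjE /= !eqxx.
exists ((Ordinal lt1, u.2) :: p); split => /=.
- by rewrite pp andbT; exact: uw.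
- by rewrite sz.
- move: un => /= ->; rewrite andbT inE negb_or; apply/andP; split.
    by apply/eqP => /(congr1 (fun w : G => nat_of_ord w.1)) /=; lia.
  by apply/negP => /(allP al) /=; rewrite ltnn.
- by rewrite leqnSn; apply/allP => w /(allP al) /=; exact: ltnW.
- by split=> //; rewrite l1 /=; lia.
Qed.

Lemma path_meets_row (u : G) (p : seq G) (r : nat) :
  path (@adj G) u p -> u.1 <= r <= (last u p).1 ->
  exists2 w : G, w \in u :: p & w.1 = r :> nat.
Proof.
elim: p u => [|w p IHp] u.
  by move=> _ rP; exists u; rewrite ?inE //; apply/eqP; rewrite eqn_leq.
rewrite last_cons => /andP[/(id : adj u w -> _) uw wp] rP; case: (leqP w.1 r) => [le_wr | lt_rw].
  have [|x xp xr] := IHp w wp; first by rewrite le_wr; case/andP: rP.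
  by exists x; rewrite // inE xp orbT.
exists u; rewrite ?inE ?eqxx //.
by move: uw; rewrite cyl_adjE; lia.
Qed.

(** A shortest path between the outer two vertices meets the row of the middle
one; by length it cannot have left the column there. *)
Lemma column_middle_blocks (M : {set G}) (a b c : 'I_s) (y : 'I_t) :
  mutual_visibility_set M ->
  (a, y) \in M -> (b, y) \in M -> (c, y) \in M -> a < b -> b < c -> False.
Proof.
move=> visM aM bM cM ab bc.
have [p [[/and3P[ap /eqP pc _] short] free]] := visM _ _ aM cM.
have [|q [aq szq uq _ [l1 l2]]] := @vertical_path (a, y) (c - a).
  by rewrite /=; have := ltn_ord c; lia.
have szp : size p <= c - a.
  rewrite -szq; apply: short; rewrite /is_path aq uq andbT.
  rewrite (surjective_pairing (last _ _)) l2 xpair_eqE eqxx andbT -val_eqE /= l1 /=.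
  by apply/eqP; lia.
have [|w wp wb] := @path_meets_row _ _ b ap; first by rewrite pc /=; lia.
have wy : w.2 = y.
  apply: val_inj => /=.
  case/splitPl: wp ap pc szp => p1 p2 l_p1.
  rewrite cat_path last_cat l_p1 size_cat => /andP[/gdist_path + /gdist_path +] l_p2.
  rewrite l_p1 l_p2 /gdist /cdist /gap /= wb.
  have := ltn_ord w.2; have := ltn_ord y.
  by move: (nat_of_ord w.2) (nat_of_ord y) => *; lia.
have wE : w = (b, y).
  by case: w wb wy {wp} => w1 w2 /= wb ->; congr (_, _); apply: val_inj.
have := free _ wp; rewrite wE !inE bM andbT negbK.
by case/orP=> /eqP[] bE; move: ab bc; rewrite bE ltnn.
Qed.

Lemma column_card (M : {set G}) (y : 'I_t) :
  mutual_visibility_set M -> #|[set x : 'I_s | (x, y) \in M]| <= 2.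
Proof.
move=> visM; rewrite leqNgt; apply/negP => /card_gt2P[a [b [c [[]]]]].
rewrite !inE => aM bM cM [ab bc ca].
move: ab bc ca; rewrite -!val_eqE /= => ab bc ca.
case: (ltngtP a b) ab => // ab _; case: (ltngtP b c) bc => // bc _;
  case: (ltngtP c a) ca => // ca _;
  by [exact: (@column_middle_blocks M a b c y) | exact: (@column_middle_blocks M a c b y)
     |exact: (@column_middle_blocks M b a c y) | exact: (@column_middle_blocks M b c a y)
     |exact: (@column_middle_blocks M c a b y) | exact: (@column_middle_blocks M c b a y)
     |lia].
Qed.

Lemma mutual_visibility_card (M : {set G}) :
  mutual_visibility_set M -> #|M| <= 2 * t.
Proof.
move=> visM.
have -> : #|M| = \sum_(y : 'I_t) #|[set x : 'I_s | (x, y) \in M]|.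
  rewrite -sum1_card (eq_bigl (fun u => (u.1, u.2) \in M)); last by case.
  under [RHS]eq_bigr do rewrite -sum1_card.
  rewrite pair_big_dep /= (reindex (fun u : 'I_t * 'I_s => (u.2, u.1))) /=.
    by apply: eq_bigl => u; rewrite inE.
  by exists (fun u : 'I_s * 'I_t => (u.2, u.1)) => -[].
rewrite mulnC -[t in t * 2]card_ord -sum_nat_const.
by apply: leq_sum => y _; exact: column_card.
Qed.

End Cylinder.

(** * Walks in coordinates *)

Definition nadj (t x c x' c' : nat) : bool :=
  ((x.+1 == x') || (x'.+1 == x)) && (c == c')
  || (cstep t c c' || cstep t c' c) && (x == x').

(** Coordinates are plain numbers rather than ordinals, so that the conditions
on a route are linear arithmetic; [F] is expected to bound them. *)
Inductive walk (t : nat) (F : nat -> nat -> Prop) (x c : nat) :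
    nat -> nat -> nat -> Prop :=
| walk0 : F x c -> walk t F x c 0 x c
| walkS n x' c' x'' c'' : walk t F x c n x' c' -> nadj t x' c' x'' c'' ->
    F x'' c'' -> walk t F x c n.+1 x'' c''.

Section Walks.
Variables (t : nat) (F : nat -> nat -> Prop).
Local Notation walk := (walk t F).

Lemma walk_cat x1 c1 n1 x2 c2 n2 x3 c3 :
  walk x1 c1 n1 x2 c2 -> walk x2 c2 n2 x3 c3 -> walk x1 c1 (n1 + n2) x3 c3.
Proof.
move=> w1; elim=> [_|n x' c' x'' c'' _ IH a f]; first by rewrite addn0.
by rewrite addnS; exact: walkS IH a f.
Qed.

Lemma walk_start x c n x' c' : walk x c n x' c' -> F x c.
Proof. by elim. Qed.

Lemma walk_end x c n x' c' : walk x c n x' c' -> F x' c'.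
Proof. by case. Qed.

Lemma walk_sym x c n x' c' : walk x c n x' c' -> walk x' c' n x c.
Proof.
elim=> [f|m x1 c1 x2 c2 w IH a f]; first exact: walk0.
have a' : nadj t x2 c2 x1 c1.
  by move: a; rewrite /nadj ![c2 == _]eq_sym ![x2 == _]eq_sym orbC (orbC (_ == _))
    (orbC (cstep _ _ _)) orbC.
have w1 : walk x2 c2 1 x1 c1 by apply: walkS a' (walk_end w); exact: walk0.
exact: walk_cat w1 IH.
Qed.

Lemma walk_up x n c :
  (forall z, x <= z <= x + n -> F z c) -> walk x c n (x + n) c.
Proof.
elim: n => [|n IHn] Fz; first by rewrite addn0; apply: walk0; apply: Fz; lia.
apply: (@walkS _ _ _ _ n (x + n) c); first by apply: IHn => z ?; apply: Fz; lia.
  by rewrite /nadj; lia.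
by apply: Fz; lia.
Qed.

Lemma walk_right x c n :
  (forall z, c <= z <= c + n -> F x z) -> walk x c n x (c + n).
Proof.
elim: n => [|n IHn] Fz; first by rewrite addn0; apply: walk0; apply: Fz; lia.
apply: (@walkS _ _ _ _ n x (c + n)); first by apply: IHn => z ?; apply: Fz; lia.
  by rewrite /nadj /cstep; lia.
by apply: Fz; lia.
Qed.

(** A shortest arc between two columns is either the interval between them or
its complement, through the wrap from [t - 1] to [0]. *)
Definition clear_arc (x c1 c2 : nat) : Prop :=
  (2 * gap c1 c2 <= t /\ forall z, minn c1 c2 <= z <= maxn c1 c2 -> F x z)
  \/ (t <= 2 * gap c1 c2
      /\ forall z, z < t -> z <= minn c1 c2 \/ maxn c1 c2 <= z -> F x z).

Lemma clear_arc_sym x c1 c2 : clear_arc x c1 c2 -> clear_arc x c2 c1.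
Proof. by rewrite /clear_arc /gap (minnC c2) (maxnC c2) (addnC (c2 - c1)). Qed.

Lemma walk_arc x c1 c2 :
  c1 < t -> c2 < t -> clear_arc x c1 c2 -> walk x c1 (cdist t c1 c2) x c2.
Proof.
move=> c1t c2t; wlog le12 : c1 c2 c1t c2t / c1 <= c2.
  move=> H clr; case: (leqP c1 c2) => [|/ltnW] le12; first exact: H.
  apply: walk_sym; rewrite (_ : cdist t c1 c2 = cdist t c2 c1).
    by apply: H => //; exact: clear_arc_sym.
  by rewrite /cdist /gap; lia.
case=> -[len Fz]; rewrite /cdist.
  have -> : minn (gap c1 c2) (t - gap c1 c2) = c2 - c1 by move: len; rewrite /gap; lia.
  have -> : c2 = c1 + (c2 - c1) by lia.
  rewrite addKn; apply: walk_right => z ?; apply: Fz; lia.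
have -> : minn (gap c1 c2) (t - gap c1 c2) = (c1 + 1) + (t - 1 - c2).
  by move: len; rewrite /gap; lia.
have w1 : walk x 0 c1 x c1.
  by rewrite -{2}[c1]add0n; apply: walk_right => z ?; apply: Fz; lia.
have w2 : walk x c2 (t - 1 - c2) x (t - 1).
  by rewrite -{2}(@subnKC c2 (t - 1)); first (apply: walk_right => z ?; apply: Fz); lia.
apply: walk_cat (walk_sym w2); rewrite addn1.
apply: (@walkS _ _ _ _ c1 x 0); first exact: walk_sym.
  by rewrite /nadj /cstep; lia.
exact: walk_end w2.
Qed.

End Walks.

Definition linked (t : nat) (F : nat -> nat -> Prop) (x1 c1 x2 c2 : nat) : Prop :=
  exists2 n, n <= gap x1 x2 + cdist t c1 c2 & walk t F x1 c1 n x2 c2.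

Lemma linked_sym t F x1 c1 x2 c2 : linked t F x1 c1 x2 c2 -> linked t F x2 c2 x1 c1.
Proof.
case=> n le_n w; exists n; last exact: walk_sym.
by move: le_n; rewrite /cdist /gap; lia.
Qed.

(** Geodesics concatenate when the rows rise throughout and the middle column
lies on a shortest arc between the outer ones. *)
Lemma linked_cat t F x1 c1 x2 c2 x3 c3 :
  x1 <= x2 <= x3 -> cdist t c1 c2 + cdist t c2 c3 <= cdist t c1 c3 ->
  linked t F x1 c1 x2 c2 -> linked t F x2 c2 x3 c3 -> linked t F x1 c1 x3 c3.
Proof.
move=> le_x le_c [n1 le_n1 w1] [n2 le_n2 w2].
exists (n1 + n2); last exact: walk_cat w2.
by move: le_n1 le_n2; rewrite /gap; lia.
Qed.

Lemma linked_up t F x1 x2 c :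
  x1 <= x2 -> (forall z, x1 <= z <= x2 -> F z c) -> linked t F x1 c x2 c.
Proof.
move=> le12 Fz; exists (x2 - x1); first by rewrite /gap; lia.
by rewrite -{2}(subnKC le12); apply: walk_up => z ?; apply: Fz; lia.
Qed.

Lemma linked_arc t F x c1 c2 :
  c1 < t -> c2 < t -> clear_arc t F x c1 c2 -> linked t F x c1 x c2.
Proof.
by move=> c1t c2t clr; exists (cdist t c1 c2); [rewrite /gap; lia | exact: walk_arc].
Qed.

(** * Sets with two vertices per column *)

Definition free (lo hi : nat -> nat) (x c : nat) : bool := (x != lo c) && (x != hi c).

(** The two endpoints belong to the set, but they do not block each other. *)
Definition usable (s t : nat) (lo hi : nat -> nat) (x1 c1 x2 c2 x c : nat) : Prop :=
  [/\ x < s, c < t & free lo hi x c \/ x = x1 /\ c = c1 \/ x = x2 /\ c = c2].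

Definition seen (s t : nat) (lo hi : nat -> nat) (x1 c1 x2 c2 : nat) : Prop :=
  linked t (usable s t lo hi x1 c1 x2 c2) x1 c1 x2 c2.

Section Profile.
Variables (s t : nat) (lo hi : nat -> nat).
Let G := path_graph s □ cycle_graph t.

Definition profile_set : {set G} :=
  [set u : 'I_s * 'I_t | (u.1 == lo u.2 :> nat) || (u.1 == hi u.2 :> nat)].

Lemma profile_card :
  (forall c, c < t -> lo c < hi c < s) -> #|profile_set| = 2 * t.
Proof.
move=> lohi.
have lo_s (c : 'I_t) : lo c < s by have := lohi c (ltn_ord c); lia.
have hi_s (c : 'I_t) : hi c < s by have := lohi c (ltn_ord c); lia.
pose L := [set ((Ordinal (lo_s c), c) : G) | c : 'I_t].
pose H := [set ((Ordinal (hi_s c), c) : G) | c : 'I_t].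
have -> : profile_set = L :|: H.
  apply/setP => -[x c]; rewrite !inE /=; congr (_ || _); apply/eqP/imsetP.
  - by move=> e; exists c => //; congr (_, _); apply: val_inj.
  - by case=> d _ [-> /= cd]; rewrite cd.
  - by move=> e; exists c => //; congr (_, _); apply: val_inj.
  - by case=> d _ [-> /= cd]; rewrite cd.
rewrite cardsU disjoint_setI0 ?cards0 ?subn0.
  by rewrite !card_imset ?card_ord ?mul2n ?addnn // => c d [].
rewrite disjoints_subset; apply/subsetP => _ /imsetP[c _ ->]; rewrite inE.
apply/negP => /imsetP[d _ [e cd]]; have := lohi d (ltn_ord d).
by move: e; rewrite cd; lia.
Qed.

Hypothesis t_gt1 : 1 < t.

Lemma walk_lift (F : nat -> nat -> Prop) (u : G) n x c :
  (forall y d, F y d -> y < s /\ d < t) -> walk t F u.1 u.2 n x c ->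
  exists p, [/\ path (@adj G) u p, size p = n,
    forall w, w \in u :: p -> F w.1 w.2
    & (last u p).1 = x :> nat /\ (last u p).2 = c :> nat].
Proof.
move=> inF; elim=> [f|m x1 c1 x2 c2 _ [p [up sz Fp [l1 l2]]] a f].
  by exists [::]; split => // w; rewrite inE => /eqP->.
have [x2s c2t] := inF _ _ f.
exists (rcons p (Ordinal x2s, Ordinal c2t)); split.
- rewrite rcons_path up cyl_adjE //= l1 l2; exact: a.
- by rewrite size_rcons sz.
- by move=> w; rewrite -rcons_cons mem_rcons inE => /predU1P[->//|]; exact: Fp.
- by rewrite last_rcons.
Qed.

Lemma profile_visible :
  (forall x1 c1 x2 c2, c1 < t -> c2 < t -> x1 = lo c1 \/ x1 = hi c1 ->
     x2 = lo c2 \/ x2 = hi c2 -> x1 <= x2 -> x2 < s -> seen s t lo hi x1 c1 x2 c2) ->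
  mutual_visibility_set profile_set.
Proof.
move=> H u v; rewrite !inE => uM vM.
have uM' : u.1 = lo u.2 :> nat \/ u.1 = hi u.2 :> nat by case/orP: uM => /eqP; auto.
have vM' : v.1 = lo v.2 :> nat \/ v.1 = hi v.2 :> nat by case/orP: vM => /eqP; auto.
have [n le_n w] : seen s t lo hi u.1 u.2 v.1 v.2.
  have := ltn_ord v.2; have := ltn_ord u.2; have := ltn_ord v.1; have := ltn_ord u.1.
  move=> us vs ut vt; case: (leqP u.1 v.1) => [|/ltnW] le_uv; first by apply: H.
  rewrite /seen (_ : usable _ _ _ _ _ _ _ _ = usable s t lo hi v.1 v.2 u.1 u.2).
    by apply: linked_sym; apply: H.
  by apply/funext => x; apply/funext => c; rewrite /usable (orC (x = u.1 /\ _)).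
have [|p [up sz Fp [l1 l2]]] := walk_lift _ w; first by move=> y d [].
have pv : last u p = v.
  by rewrite (surjective_pairing v) -(val_inj l1) -(val_inj l2); case: (last _ _).
apply: (geodesic_visible _ up pv) => //; first by rewrite sz.
move=> x /Fp[_ _ xF]; rewrite inE => xM.
have eqG (y z : G) : y.1 = z.1 :> nat -> y.2 = z.2 :> nat -> y = z.
  by case: y z => [y1 y2] [z1 z2] /= /val_inj-> /val_inj->.
case: xF => [/andP[/negPf xl /negPf xh]|[[e1 e2]|[e1 e2]]].
- by rewrite xl xh in xM.
- by left; apply: eqG.
- by right; apply: eqG.
Qed.

End Profile.

Lemma mu_ge_profile (s t : nat) (lo hi : nat -> nat) : 1 < t ->
  (forall c, c < t -> lo c < hi c < s) ->
  (forall x1 c1 x2 c2, c1 < t -> c2 < t -> x1 = lo c1 \/ x1 = hi c1 ->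
     x2 = lo c2 \/ x2 = hi c2 -> x1 <= x2 -> x2 < s -> seen s t lo hi x1 c1 x2 c2) ->
  2 * t <= mu (path_graph s □ cycle_graph t).
Proof.
move=> t1 lohi /(profile_visible t1) vis; rewrite -(profile_card lohi) /mu.
by apply: (leq_bigmax_cond (profile_set s t lo hi)); apply/asboolP.
Qed.

(** * Monotone routes and transparent rows *)

Section Routes.
Variables (s t : nat) (lo hi : nat -> nat) (x1 c1 x2 c2 : nat).
Hypotheses (c1t : c1 < t) (c2t : c2 < t) (x2s : x2 < s) (x12 : x1 <= x2).
Let F := usable s t lo hi x1 c1 x2 c2.
Local Notation free := (free lo hi).
Local Notation goal := (seen s t lo hi x1 c1 x2 c2).

Definition open_arc_free (x c c' : nat) : Prop :=
  (2 * gap c c' <= t /\ forall z, minn c c' < z < maxn c c' -> free x z)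
  \/ (t <= 2 * gap c c'
      /\ forall z, z < t -> z < minn c c' \/ maxn c c' < z -> free x z).

Let F_free x c : x <= x2 -> c < t -> free x c -> F x c.
Proof. by move=> ? ? ?; split; [lia | | left]. Qed.

Let F_start : F x1 c1.
Proof. by split; [lia | | right; left]. Qed.

Let F_end : F x2 c2.
Proof. by split; [lia | | right; right]. Qed.

Let arc x c c' : x <= x2 -> c < t -> c' < t -> F x c -> F x c' ->
  open_arc_free x c c' -> linked t F x c x c'.
Proof.
move=> xx2 ct c't Fc Fc' clr; apply: linked_arc => //.
case: clr => -[len fr]; [left | right]; split => // z.
  move=> zP; case: (z =P c) => [-> // | zc]; case: (z =P c') => [-> // | zc'].
  by apply: F_free; [ | lia | apply: fr; lia].
move=> zt zP; case: (z =P c) => [-> // | zc]; case: (z =P c') => [-> // | zc'].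
by apply: F_free => //; apply: fr; lia.
Qed.

Let from_start r : x1 <= r <= x2 -> (forall z, x1 < z <= r -> free z c1) ->
  forall z, x1 <= z <= r -> F z c1.
Proof.
move=> rP fr z zP; case: (z =P x1) => [-> // | zx1].
by apply: F_free; [lia | | apply: fr; lia].
Qed.

Let to_end r : x1 <= r <= x2 -> (forall z, r <= z < x2 -> free z c2) ->
  forall z, r <= z <= x2 -> F z c2.
Proof.
move=> rP fr z zP; case: (z =P x2) => [-> // | zx2].
by apply: F_free; [lia | | apply: fr; lia].
Qed.

Let start r : x1 <= r <= x2 -> (forall z, x1 < z <= r -> free z c1) ->
  linked t F x1 c1 r c1.
Proof. by move=> rP /(from_start rP) F1; apply: linked_up => //; lia. Qed.

Let extend r c r' c' : linked t F x1 c1 r c -> F r c -> c < t ->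
  x1 <= r -> r <= r' -> r' <= x2 -> c' < t ->
  cdist t c1 c + cdist t c c' <= cdist t c1 c' ->
  open_arc_free r c c' -> (forall z, r <= z <= r' -> free z c') ->
  linked t F x1 c1 r' c'.
Proof.
move=> w Frc ct x1r rr' r'x2 c't on_way clr fr.
have Fc z : r <= z <= r' -> F z c' by move=> zP; apply: F_free; [lia | | exact: fr].
apply: (@linked_cat _ _ _ _ r c' r' c'); [lia | by rewrite /cdist /gap; lia | |].
  apply: (@linked_cat _ _ _ _ r c); [lia | done | done |].
  by apply: arc => //; [lia | apply: Fc; lia].
by apply: linked_up.
Qed.

Let finish r c : linked t F x1 c1 r c -> F r c -> c < t -> x1 <= r <= x2 ->
  cdist t c1 c + cdist t c c2 <= cdist t c1 c2 ->
  open_arc_free r c c2 -> (forall z, r <= z < x2 -> free z c2) -> goal.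
Proof.
move=> w Frc ct rP on_way clr /(to_end rP) F2.
apply: (@linked_cat _ _ _ _ r c2 x2 c2); [lia | by rewrite /cdist /gap; lia | |].
  apply: (@linked_cat _ _ _ _ r c); [lia | done | done |].
  by apply: arc => //; [lia | apply: F2; lia].
by apply: linked_up => //; lia.
Qed.

(** [route3], [route5] and [route7] alternate vertical segments and arcs,
with that many legs; [r], [c], [r'] and so on are the rows of the arcs and the
columns of the inner vertical segments in the order of travel.  A leg may have
length zero. *)
Lemma route3 r : x1 <= r <= x2 ->
  (forall z, x1 < z <= r -> free z c1) -> open_arc_free r c1 c2 ->
  (forall z, r <= z < x2 -> free z c2) -> goal.
Proof.
move=> rP fr clr fr2; apply: (@finish r c1) => //; first exact: start.
  by apply: (from_start (r := r)) => //; lia.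
by rewrite /cdist /gap; lia.
Qed.

Lemma route5 r c r' : x1 <= r -> r <= r' -> r' <= x2 -> c < t ->
  cdist t c1 c + cdist t c c2 <= cdist t c1 c2 ->
  (forall z, x1 < z <= r -> free z c1) -> open_arc_free r c1 c ->
  (forall z, r <= z <= r' -> free z c) -> open_arc_free r' c c2 ->
  (forall z, r' <= z < x2 -> free z c2) -> goal.
Proof.
move=> x1r rr' r'x2 ct on_way fr1 clr fr clr' fr2.
apply: (@finish r' c) => //; [| by apply: F_free => //; apply: fr; lia | lia].
apply: (@extend r c1) => //;
  [apply: start => // | apply: (from_start (r := r)) => // |]; try lia.
by rewrite /cdist /gap; lia.
Qed.

Lemma route7 r c r' c' r'' :
  x1 <= r -> r <= r' -> r' <= r'' -> r'' <= x2 -> c < t -> c' < t ->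
  cdist t c1 c + cdist t c c' <= cdist t c1 c' ->
  cdist t c1 c' + cdist t c' c2 <= cdist t c1 c2 ->
  (forall z, x1 < z <= r -> free z c1) -> open_arc_free r c1 c ->
  (forall z, r <= z <= r' -> free z c) -> open_arc_free r' c c' ->
  (forall z, r' <= z <= r'' -> free z c') -> open_arc_free r'' c' c2 ->
  (forall z, r'' <= z < x2 -> free z c2) -> goal.
Proof.
move=> x1r rr' r'r'' r''x2 ct c't way1 way2 fr1 clr fr clr' fr' clr'' fr2.
apply: (@finish r'' c') => //; [| by apply: F_free => //; apply: fr'; lia | lia].
apply: (@extend r' c) => //; [| by apply: F_free; [lia | | apply: fr; lia] | lia].
apply: (@extend r c1) => //;
  [apply: start => // | apply: (from_start (r := r)) => // | |]; try lia.
by rewrite /cdist /gap; lia.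
Qed.

(** Seen from column [c0], all other occupied columns of row [x] are as far
away as the cycle permits.  There are two possible values of [gap] because it
is not the cyclic distance. *)
Definition balanced (x c0 : nat) : Prop :=
  forall c, c < t -> ~~ free x c ->
    c = c0 \/ gap c c0 = t./2 \/ gap c c0 = t - t./2.

Lemma balanced_arc x c0 c : c0 < t -> c < t -> balanced x c0 -> open_arc_free x c0 c.
Proof.
move=> c0t ct bal; rewrite /open_arc_free.
case: (leqP (2 * gap c0 c) t) => len; [left | right]; split; rewrite 1?ltnW // => z.
  move=> zP; apply/contraT => /bal; rewrite /gap in len *; lia.
by move=> zt zP; apply/contraT => /bal; rewrite /gap in len *; lia.
Qed.

Lemma open_arc_free_sym x c c' : open_arc_free x c c' -> open_arc_free x c' c.
Proof. by rewrite /open_arc_free /gap (minnC c') (maxnC c') (addnC (c' - c)). Qed.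

Hypotheses (lohi1 : lo c1 < hi c1) (lohi2 : lo c2 < hi c2).
Hypotheses (P1 : x1 = lo c1 \/ x1 = hi c1) (P2 : x2 = lo c2 \/ x2 = hi c2).

Lemma corner_up : c1 <> c2 -> balanced x2 c2 -> x1 = hi c1 \/ x2 < hi c1 -> goal.
Proof.
move=> c12 bal col; apply: (@route3 x2); [lia | | |lia].
- by move=> z zP; rewrite /free; lia.
- by apply: open_arc_free_sym; exact: balanced_arc.
Qed.

Lemma corner_right : c1 <> c2 -> balanced x1 c1 -> x2 = lo c2 \/ lo c2 < x1 -> goal.
Proof.
move=> c12 bal col; apply: (@route3 x1); [lia | lia | |].
- exact: balanced_arc.
- by move=> z zP; rewrite /free; lia.
Qed.

Lemma same_column : c1 = c2 -> goal.
Proof.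
move=> c12; suff up : linked t F x1 c1 x2 c1 by rewrite /seen -[in X in linked _ _ _ _ _ X]c12.
apply: linked_up => // z zP.
case: (z =P x1) => [-> // | zx1]; case: (z =P x2) => [-> | zx2]; first by rewrite c12.
by apply: F_free; [lia | | move: P1 P2; rewrite /free -c12; lia].
Qed.

End Routes.

(** * Odd cycles *)

Section OddCycle.
Variables (s h : nat).
Hypothesis h_ge3 : 3 <= h.

Definition lo_odd (c : nat) : nat := if c < h then c else if c < 2 * h then c - h else 0.
Definition hi_odd (c : nat) : nat := 2 * h - 1 - lo_odd c.

Local Notation seen := (seen s (2 * h + 1) lo_odd hi_odd).

Lemma lo_hi_oddP c : c < 2 * h + 1 ->
  [\/ [/\ c = 0 \/ c = h \/ c = 2 * h, lo_odd c = 0 & hi_odd c = 2 * h - 1],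
      [/\ 0 < c < h, lo_odd c = c & hi_odd c = 2 * h - 1 - c]
    | [/\ h < c < 2 * h, lo_odd c = c - h & hi_odd c = 2 * h - 1 - (c - h)]].
Proof.
rewrite /hi_odd /lo_odd => c_lt.
case: (c =P 0) => [->|c0].
  by constructor 1; split; do ?case: ifP; lia.
case: (c =P h) => [->|ch].
  by constructor 1; split; do ?case: ifP; lia.
case: ltnP => clh; first by constructor 2; split; lia.
case: ltnP => cl2h; first by constructor 3; split; lia.
by constructor 1; split; lia.
Qed.

Ltac odd_cases c e e' :=
  let H := fresh in have H : c < 2 * h + 1 by [lia];
  have [[? e e']|[? e e']|[? e e']] := lo_hi_oddP H; clear H.

Lemma odd_balanced x c0 : c0 < 2 * h + 1 -> x = lo_odd c0 \/ x = hi_odd c0 ->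
  0 < x < 2 * h - 1 -> balanced (2 * h + 1) lo_odd hi_odd x c0.
Proof.
move=> c0t xP xin c ct; rewrite /free /gap; move: xP.
have -> : (2 * h + 1)./2 = h by lia.
by odd_cases c0 e0 e0'; odd_cases c e e'; rewrite e0 e e0' e'; lia.
Qed.

Ltac solve_free z :=
  rewrite /free; let e := fresh in let e' := fresh in
  odd_cases z e e'; rewrite ?e ?e'; lia.
Ltac arc_inside :=
  left; split; [rewrite /gap; lia | let z := fresh in move=> z ?; solve_free z].
Ltac arc_outside :=
  right; split; [rewrite /gap; lia | let z := fresh in move=> z ? ?; solve_free z].
Ltac column z := let k := fresh in move=> k ?; solve_free z.
Ltac use_route3 r := apply: (@route3 _ _ _ _ _ _ _ _ _ _ _ _ r); try lia.
Ltac use_route5 r c r' :=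
  apply: (@route5 _ _ _ _ _ _ _ _ _ _ _ _ r c r'); rewrite /cdist /gap; try lia.

Lemma odd_extreme_row x c1 c2 : x < s -> x = 0 \/ x = 2 * h - 1 -> c1 <> c2 ->
  c1 = 0 \/ c1 = h \/ c1 = 2 * h -> c2 = 0 \/ c2 = h \/ c2 = 2 * h ->
  seen x c1 x c2.
Proof.
move=> xs xE c12 c1E c2E; use_route3 x.
case: c1E => [|[]] c1E; case: c2E => [|[]] c2E; subst c1 c2; try lia.
all: by [arc_inside | arc_outside].
Qed.

(** Columns [h - 1] and [2 * h - 1] hold their two vertices in the adjacent
middle rows, so nothing passes between those.  A route to or from column [h]
therefore crosses the columns in between along an extreme row, and shifts by
one row just before or after the column where that extreme row is occupied. *)
Lemma odd_opposite_extremes c1 c2 : 2 * h - 1 < s -> c1 <> c2 ->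
  c1 = 0 \/ c1 = h \/ c1 = 2 * h -> c2 = 0 \/ c2 = h \/ c2 = 2 * h ->
  seen 0 c1 (2 * h - 1) c2.
Proof.
move=> xs c12 c1E c2E.
case: c1E => [|[]] c1E; case: c2E => [|[]] c2E; subst c1 c2; try lia.
- use_route5 0 (h - 1) 1.
  + by arc_inside.
  + by column (h - 1).
  + by arc_inside.
  + by column h.
- use_route3 1.
  + by column 0.
  + by arc_outside.
  + by column (2 * h).
- use_route5 (2 * h - 2) (h - 1) (2 * h - 1).
  + by column h.
  + by arc_inside.
  + by column (h - 1).
  + by arc_inside.
- use_route5 0 (2 * h - 1) 1.
  + by arc_inside.
  + by column (2 * h - 1).
  + by arc_inside.
  + by column (2 * h).
- use_route3 1.
  + by column (2 * h).
  + by arc_outside.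
  + by column 0.
- use_route5 (2 * h - 2) (2 * h - 1) (2 * h - 1).
  + by column (2 * h).
  + by arc_inside.
  + by column (2 * h - 1).
  + by arc_inside.
Qed.

(** Column [h] lies between the two columns, and its long interval leaves all
rows in between open. *)
Lemma odd_antipodal k c1 c2 : 0 < k < h -> 2 * h - 1 - k < s ->
  c1 = k /\ c2 = k + h \/ c1 = k + h /\ c2 = k ->
  seen k c1 (2 * h - 1 - k) c2.
Proof.
move=> kP xs [] [-> ->].
all: use_route5 k h (2 * h - 1 - k).
all: by [arc_inside | column h].
Qed.

Lemma odd_visible x1 c1 x2 c2 : c1 < 2 * h + 1 -> c2 < 2 * h + 1 ->
  x1 = lo_odd c1 \/ x1 = hi_odd c1 -> x2 = lo_odd c2 \/ x2 = hi_odd c2 ->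
  x1 <= x2 -> x2 < s -> seen x1 c1 x2 c2.
Proof.
move=> c1t c2t P1 P2 x12 x2s.
have lohi c : c < 2 * h + 1 -> lo_odd c < hi_odd c.
  by move=> ct; odd_cases c e e'; lia.
case: (c1 =P c2) => [c12 | c12].
  by apply: same_column => //; exact: lohi.
have up : 0 < x2 < 2 * h - 1 -> x1 = hi_odd c1 \/ x2 < hi_odd c1 -> seen x1 c1 x2 c2.
  by move=> x2in col; apply: corner_up => //; try exact: lohi; apply: odd_balanced.
have right : 0 < x1 < 2 * h - 1 -> x2 = lo_odd c2 \/ lo_odd c2 < x1 -> seen x1 c1 x2 c2.
  by move=> x1in col; apply: corner_right => //; try exact: lohi; apply: odd_balanced.
have row : x1 = x2 -> x1 = 0 \/ x1 = 2 * h - 1 ->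
    c1 = 0 \/ c1 = h \/ c1 = 2 * h -> c2 = 0 \/ c2 = h \/ c2 = 2 * h ->
    seen x1 c1 x2 c2.
  by move=> xe ext c1E c2E; rewrite -xe; apply: odd_extreme_row => //; rewrite xe.
have opposite : x1 = 0 -> x2 = 2 * h - 1 ->
    c1 = 0 \/ c1 = h \/ c1 = 2 * h -> c2 = 0 \/ c2 = h \/ c2 = 2 * h ->
    seen x1 c1 x2 c2.
  by move=> -> xE c1E c2E; rewrite xE; apply: odd_opposite_extremes => //; lia.
have anti k : 0 < k < h -> x1 = k -> x2 = 2 * h - 1 - k ->
    c1 = k /\ c2 = k + h \/ c1 = k + h /\ c2 = k -> seen x1 c1 x2 c2.
  by move=> kP -> xE cP; rewrite xE; apply: odd_antipodal => //; lia.
clear lohi x2s; move: P1 P2.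
odd_cases c1 e1 e1'; odd_cases c2 e2 e2'; rewrite ?e1 ?e1' ?e2 ?e2' in up right *;
  clear e1 e1' e2 e2'; (case=> E1; case=> E2);
  try lia; try (apply: row; lia); try (apply: opposite; lia);
  try (apply: up; lia); try (apply: right; lia).
(* Two inner columns, a lower and an upper vertex: the intervals are compared. *)
all: case: (ltngtP x1 (2 * h - 1 - x2)) => cmp;
  first [apply: up; lia | apply: right; lia | apply: (anti x1); lia].
Qed.

End OddCycle.

(** * Even cycles of length at least eight *)

Section EvenCycle.
Variables (s h : nat).
Hypothesis h_ge4 : 4 <= h.

(** As in the odd case the lower vertex would be in row [c] or [c - h]; columns
[h - 1] and [2 * h - 1] take row [0] instead.  Thus all columns next to [0] or
[h] have intervals that reach the extreme rows or come within one row of them,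
which the routes out of columns [0] and [h] use. *)
Definition lo_even (c : nat) : nat :=
  if c == h then h - 1 else if (c == h - 1) || (c == 2 * h - 1) then 0
  else if c < h then c else c - h.
Definition hi_even (c : nat) : nat :=
  if c == h then 2 * h - 2 else if c == 0 then h - 1 else 2 * h - 2 - lo_even c.

Local Notation seen := (seen s (2 * h) lo_even hi_even).

Lemma lo_hi_evenP c : c < 2 * h ->
  [\/ [\/ [/\ c = 0, lo_even c = 0 & hi_even c = h - 1]
        | [/\ c = h, lo_even c = h - 1 & hi_even c = 2 * h - 2]],
      [/\ c = h - 1 \/ c = 2 * h - 1, lo_even c = 0 & hi_even c = 2 * h - 2],
      [/\ 0 < c < h - 1, lo_even c = c & hi_even c = 2 * h - 2 - c]
    | [/\ h < c < 2 * h - 1, lo_even c = c - h & hi_even c = 2 * h - 2 - (c - h)]].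
Proof.
rewrite /hi_even /lo_even => c_lt.
case: (c =P h) => [->|ch]; first by constructor 1; right; split; lia.
case: (c =P 0) => [->|c0].
  by constructor 1; left; split => //; do ?case: ifP; lia.
case: (boolP (_ || _)) => cE; first by constructor 2; split; lia.
by case: ltnP => ?; [constructor 3 | constructor 4]; split; lia.
Qed.

Ltac even_cases c e e' :=
  let H := fresh in have H : c < 2 * h by [lia];
  have [[[? e e']|[? e e']]|[? e e']|[? e e']|[? e e']] := lo_hi_evenP H; clear H.

Lemma even_balanced x c0 : c0 < 2 * h -> x = lo_even c0 \/ x = hi_even c0 ->
  0 < x < 2 * h - 2 -> balanced (2 * h) lo_even hi_even x c0.
Proof.
move=> c0t xP xin c ct; rewrite /free /gap; move: xP.
have -> : (2 * h)./2 = h by lia.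
by even_cases c0 e0 e0'; even_cases c e e'; rewrite e0 e e0' e'; lia.
Qed.

Ltac solve_free z :=
  rewrite /free; let e := fresh in let e' := fresh in
  even_cases z e e'; rewrite ?e ?e'; lia.
Ltac arc_inside :=
  left; split; [rewrite /gap; lia | let z := fresh in move=> z ?; solve_free z].
Ltac arc_outside :=
  right; split; [rewrite /gap; lia | let z := fresh in move=> z ? ?; solve_free z].
Ltac column z := let k := fresh in move=> k ?; solve_free z.
Ltac use_route5 r c r' :=
  apply: (@route5 _ _ _ _ _ _ _ _ _ _ _ _ r c r'); rewrite /cdist /gap; try lia.

(** The vertex in row [h - 1] above the start stops the ascent in column [0].
The two neighbouring columns have their lower vertex in row at most [1], so one
can leave sideways in row [2] and climb to the middle row, where only columns
[0] and [h] are occupied. *)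
Lemma even_from_bottom c x : 0 < c < 2 * h -> x < s ->
  x = hi_even c \/ c = h /\ x = h - 1 -> seen 0 0 x c.
Proof.
move=> c_lt xs xP.
have x_ge : h - 1 <= x by move: xP; even_cases c e e'; lia.
case: (c =P h) => [ch | c_neq_h].
  subst c; case: xP => [xE | [_ xE]].
    have {}xE : x = 2 * h - 2 by move: xE; even_cases h e e'; lia.
    (* Column [h] is entered above the middle row, by the mirror image of the
       way out of column [0]. *)
    apply: (@route7 _ _ _ _ _ _ _ _ _ _ _ _ 2 1 (h - 1) (h - 1) (2 * h - 4));
      rewrite /cdist /gap; try lia.
    - by column 0.
    - by arc_inside.
    - by column 1.
    - by arc_inside.
    - by column (h - 1).
    - by arc_inside.
    - by column h.
  use_route5 2 1 (h - 1).
  - by column 0.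
  - by arc_inside.
  - by column 1.
  - by arc_inside.
have {}xP : x = hi_even c by case: xP => // -[].
case: (ltnP c h) => ch.
  use_route5 2 1 (h - 1).
  - by column 0.
  - by arc_inside.
  - by column 1.
  - by arc_inside.
  - by move: xP; column c.
use_route5 2 (2 * h - 1) (h - 1).
- by column 0.
- by arc_outside.
- by column (2 * h - 1).
- by arc_inside.
- by move: xP; column c.
Qed.

(** The half-turn that reverses the rows and shifts the columns by [h]
preserves the placement and exchanges this case with [even_from_bottom]. *)
Lemma even_to_top c x : c < 2 * h -> c <> h -> 2 * h - 2 < s ->
  x = lo_even c /\ 0 < c \/ c = 0 /\ x = h - 1 -> seen x c (2 * h - 2) h.
Proof.
move=> c_lt ch xs xP.
have x_le : x <= h - 1 by move: xP; even_cases c e e'; lia.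
case: (ltnP c h) => c_h.
  use_route5 (h - 1) (h - 1) (2 * h - 4).
  - by move: xP; column c.
  - by arc_inside.
  - by column (h - 1).
  - by arc_inside.
  - by column h.
use_route5 (h - 1) (h + 1) (2 * h - 4).
- by move: xP; column c.
- by arc_inside.
- by column (h + 1).
- by arc_inside.
- by column h.
Qed.

(** Both routes pass through column [0], off the middle row: the first one
above it and the second one below it. *)
Lemma even_opposite_extremes c1 c2 : 2 * h - 2 < s ->
  c1 = h - 1 /\ c2 = 2 * h - 1 \/ c1 = 2 * h - 1 /\ c2 = h - 1 ->
  seen 0 c1 (2 * h - 2) c2.
Proof.
move=> xs [] [-> ->].
  use_route5 (h - 1) 1 (2 * h - 4).
  - by column (h - 1).
  - by arc_inside.
  - by column 1.
  - by arc_outside.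
  - by column (2 * h - 1).
use_route5 2 1 (h - 1).
- by column (2 * h - 1).
- by arc_outside.
- by column 1.
- by arc_inside.
- by column (h - 1).
Qed.

(** Column [h - 1] lies between the two columns, and its long interval leaves
all rows in between open. *)
Lemma even_antipodal k c1 c2 : 0 < k < h - 1 -> 2 * h - 2 - k < s ->
  c1 = k /\ c2 = k + h \/ c1 = k + h /\ c2 = k ->
  seen k c1 (2 * h - 2 - k) c2.
Proof.
move=> kP xs [] [-> ->].
all: use_route5 k (h - 1) (2 * h - 2 - k).
all: by [arc_inside | column (h - 1)].
Qed.

Lemma even_extreme_row x c1 c2 : c1 < 2 * h -> c2 < 2 * h -> x < s -> c1 <> c2 ->
  x = lo_even c1 \/ x = hi_even c1 -> x = lo_even c2 \/ x = hi_even c2 ->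
  x = 0 \/ x = 2 * h - 2 -> seen x c1 x c2.
Proof.
move=> c1t c2t xs c12 P1 P2 xE.
apply: (@route3 _ _ _ _ _ _ _ _ _ _ _ _ x); try lia.
move: P1 P2; even_cases c1 e1 e1'; even_cases c2 e2 e2'; try lia;
  rewrite e1 e2 e1' e2' => P1 P2.
all: clear e1 e2 e1' e2'.
all: repeat match goal with H : _ \/ _ |- _ => destruct H end; try lia; subst; try lia.
all: first [by arc_inside | by arc_outside].
Qed.

Lemma even_visible x1 c1 x2 c2 : c1 < 2 * h -> c2 < 2 * h ->
  x1 = lo_even c1 \/ x1 = hi_even c1 -> x2 = lo_even c2 \/ x2 = hi_even c2 ->
  x1 <= x2 -> x2 < s -> seen x1 c1 x2 c2.
Proof.
move=> c1t c2t P1 P2 x12 x2s.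
have lohi c : c < 2 * h -> lo_even c < hi_even c.
  by move=> ct; even_cases c e e'; lia.
case: (c1 =P c2) => [c12 | c12].
  by apply: same_column => //; exact: lohi.
have up : 0 < x2 < 2 * h - 2 -> x1 = hi_even c1 \/ x2 < hi_even c1 -> seen x1 c1 x2 c2.
  by move=> x2in col; apply: corner_up => //; try exact: lohi; apply: even_balanced.
have right : 0 < x1 < 2 * h - 2 -> x2 = lo_even c2 \/ lo_even c2 < x1 -> seen x1 c1 x2 c2.
  by move=> x1in col; apply: corner_right => //; try exact: lohi; apply: even_balanced.
have row : x1 = x2 -> x1 = 0 \/ x1 = 2 * h - 2 -> seen x1 c1 x2 c2.
  by move=> xe ext; rewrite -xe; apply: even_extreme_row => //; rewrite xe.
have bottom : x1 = 0 -> c1 = 0 -> x2 = hi_even c2 \/ c2 = h /\ x2 = h - 1 ->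
    seen x1 c1 x2 c2.
  by move=> -> c10 xP; rewrite c10; apply: even_from_bottom => //; lia.
have top : x2 = 2 * h - 2 -> c2 = h -> x1 = lo_even c1 /\ 0 < c1 \/ c1 = 0 /\ x1 = h - 1 ->
    seen x1 c1 x2 c2.
  by move=> xE c2h xP; rewrite xE c2h; apply: even_to_top; lia.
have opposite : x1 = 0 -> x2 = 2 * h - 2 ->
    c1 = h - 1 /\ c2 = 2 * h - 1 \/ c1 = 2 * h - 1 /\ c2 = h - 1 -> seen x1 c1 x2 c2.
  by move=> -> xE cP; rewrite xE; apply: even_opposite_extremes => //; lia.
have anti k : 0 < k < h - 1 -> x1 = k -> x2 = 2 * h - 2 - k ->
    c1 = k /\ c2 = k + h \/ c1 = k + h /\ c2 = k -> seen x1 c1 x2 c2.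
  by move=> kP -> xE cP; rewrite xE; apply: even_antipodal => //; lia.
clear lohi x2s; move: P1 P2.
even_cases c1 e1 e1'; even_cases c2 e2 e2';
  rewrite ?e1 ?e1' ?e2 ?e2' in up right bottom top *;
  clear e1 e1' e2 e2'; (case=> E1; case=> E2);
  try lia; try (apply: row; lia);
  try (apply: bottom; lia); try (apply: top; lia); try (apply: opposite; lia);
  try (apply: up; lia); try (apply: right; lia).
(* What is left is a lower and an upper vertex whose intervals are centered at
   the middle row, so that they are nested. *)
all: case: (ltngtP x1 (2 * h - 2 - x2)) => cmp;
  first [apply: up; lia | apply: right; lia | apply: (anti x1); lia].
Qed.

End EvenCycle.

(** * The cycle of length six *)

(** A geodesic that rises in the rows turns around the cycle in one direction
only, so moving up or to [next] reaches everything that is visible. *)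
Fixpoint climb (ok : nat -> nat -> bool) (next : nat -> nat) (n x c x' c' : nat) : bool :=
  ok x c && ((x == x') && (c == c') ||
    if n is m.+1 then climb ok next m x.+1 c x' c' || climb ok next m x (next c) x' c'
    else false).

Lemma climb_walk t (ok : nat -> nat -> bool) next (F : nat -> nat -> Prop) n x c x' c' :
  (forall y d, ok y d -> F y d) ->
  (forall y d, ok y d -> cstep t d (next d) || cstep t (next d) d) ->
  climb ok next n x c x' c' -> exists2 m, m <= n & walk t F x c m x' c'.
Proof.
move=> okF okN; have one y d y' d' : F y d -> nadj t y d y' d' -> F y' d' ->
    walk t F y d 1 y' d'.
  by move=> f a f'; apply: (@walkS _ _ _ _ 0 y d) => //; exact: walk0.
have stop n' y d : ok y d && ((y == x') && (d == c')) ->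
    exists2 m, m <= n' & walk t F y d m x' c'.
  by case/andP=> /okF f /andP[/eqP <- /eqP <-]; exists 0 => //; exact: walk0.
elim: n x c => [|n IHn] x c /=; first by rewrite orbF; exact: stop.
case/andP=> okx /orP[e | /orP[] /IHn [m le_mn w]]; first by apply: stop; rewrite okx.
all: exists (1 + m); rewrite ?add1n ?ltnS // -add1n.
all: apply: walk_cat (w); apply: one (okF _ _ okx) _ (walk_start w).
  by rewrite /nadj !eqxx.
by rewrite /nadj eqxx andbT (okN _ _ okx) orbT.
Qed.

Definition lo_six (c : nat) : nat := nth 0 [:: 2; 0; 1; 0; 1; 0] c.
Definition hi_six (c : nat) : nat := nth 0 [:: 3; 4; 2; 4; 3; 4] c.

Definition six_ok (x1 c1 x2 c2 x c : nat) : bool :=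
  [&& x < 5, c < 6 & [|| free lo_six hi_six x c, (x == x1) && (c == c1)
    | (x == x2) && (c == c2)]].

Lemma six_climb : all (fun c1 => all (fun c2 =>
    all (fun x1 => all (fun x2 => (x1 <= x2) ==>
      has (fun next => climb (six_ok x1 c1 x2 c2) next (gap x1 x2 + cdist 6 c1 c2) x1 c1 x2 c2)
        [:: fun c => c.+1 %% 6; fun c => (c + 5) %% 6])
    [:: lo_six c2; hi_six c2]) [:: lo_six c1; hi_six c1]) (iota 0 6)) (iota 0 6).
Proof. by vm_compute. Qed.

Lemma six_visible s x1 c1 x2 c2 : 5 <= s -> c1 < 6 -> c2 < 6 ->
  x1 = lo_six c1 \/ x1 = hi_six c1 -> x2 = lo_six c2 \/ x2 = hi_six c2 ->
  x1 <= x2 -> seen s 6 lo_six hi_six x1 c1 x2 c2.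
Proof.
move=> s5 c1t c2t P1 P2 x12.
have mem6 c : c < 6 -> c \in iota 0 6 by rewrite mem_iota.
have memP x c : x = lo_six c \/ x = hi_six c -> x \in [:: lo_six c; hi_six c].
  by rewrite !inE => -[->|->]; rewrite eqxx ?orbT.
have /allP/(_ _ (mem6 _ c1t))/allP/(_ _ (mem6 _ c2t)) := six_climb.
move=> /allP/(_ _ (memP _ _ P1))/allP/(_ _ (memP _ _ P2)); rewrite x12 implyTb.
have okF y d : six_ok x1 c1 x2 c2 y d -> usable s 6 lo_six hi_six x1 c1 x2 c2 y d.
  case/and3P=> y5 d6 fr; split; [lia | by [] |].
  by case/or3P: fr => [|/andP[/eqP-> /eqP->]|/andP[/eqP-> /eqP->]]; auto.
have next_ok f : all (fun d => cstep 6 d (f d) || cstep 6 (f d) d) (iota 0 6) ->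
    forall y d, six_ok x1 c1 x2 c2 y d -> cstep 6 d (f d) || cstep 6 (f d) d.
  by move=> /allP H y d /and3P[_ d6 _]; exact: H (mem6 _ d6).
rewrite /= orbF => /orP[] /climb_walk; apply => //; exact: next_ok.
Qed.

Unset Implicit Arguments.

Theorem theorem2p4 (s t : nat) (ht : 6 <= t) (hst : t <= s + 1) :
  mu (path_graph s □ cycle_graph t) = 2 * t.
Proof.
have t1 : 1 < t by lia.
apply/eqP; rewrite eqn_leq; apply/andP; split.
  by apply/bigmax_leqP => M /asboolP; exact: mutual_visibility_card.
have [h tE] : exists h, t = 2 * h \/ t = 2 * h + 1 by exists t./2; lia.
case: tE => tE; subst t.
  case: (ltnP h 4) => h4.
    have h3 : h = 3 by lia.
    subst h; apply: (mu_ge_profile (lo := lo_six) (hi := hi_six)) => // [c c6 | *].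
      by do 6?[case: c c6 => [|c] c6]; rewrite /lo_six /hi_six /=; lia.
    by apply: six_visible; lia.
  apply: (mu_ge_profile (lo := lo_even h) (hi := hi_even h)) => // [c ct | *].
    by have [[[? -> ->]|[? -> ->]]|[? -> ->]|[? -> ->]|[? -> ->]] := lo_hi_evenP h4 ct; lia.
  exact: even_visible.
apply: (mu_ge_profile (lo := lo_odd h) (hi := hi_odd h)) => // [c ct | *].
  by have [|[? -> ->]|[? -> ->]|[? -> ->]] := @lo_hi_oddP h _ c ct; lia.
by apply: odd_visible; lia.
Qed.
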